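(* Let $T>0$ and $g:\mathbb{R}^n\to\mathbb{R}$, and let $\mu_{g,T}=\mathbb{E}[g(\bm{X}(T))]$, where $\bm{X}$ is the solution of the jump SDE system $d\bm{X}(t)=\bm{c}(\bm{X}(t^-))\,d\bm{J}(t)$ described in the context. Let $u_T(h,L)$ be the sample approximation of $\mu_{g,T}$ generated by the antithetic sampling algorithm described in the context, using a numerical SDE scheme (the Euler scheme or the Taylor scheme of the context) of weak order $\beta>0$, with step size $h$ and $L$ sample trajectories. Suppose that (1) $g$ satisfies polynomial growth, i.e. there exist $C>0$ and a positive integer $s$ such that $g(\bm{x})\le C(1+\|\bm{x}\|^s)$ for all $\bm{x}\in\mathbb{R}^n$; and (2) $\mathbb{E}[g^2(\bm{X}(T))]<\infty$. Let $e_T(h,L)=\{\mathbb{E}[|u_T(h,L)-\mu_{g,T}|^2]\}^{1/2}$ be the root mean squared error (RMSE). Let $C_{g,T}>0$ be the constant, independent of $h$, in the weak order bound $|\mathbb{E}[g(\bm{X}^h(T))]-\mathbb{E}[g(\bm{X}(T))]|\le C_{g,T}h^\beta$, and let $\sigma_{g,T}^2$ be the constant, dependent on $g$ and $T$ but not on $h$ and $\beta$, in the RMSE bound $e_T(h,L)\le(\sigma_{g,T}^2/L+C_{g,T}^2h^{2\beta})^{1/2}$, which holds under these conditions. Then for any $\epsilon>0$, the RMSE satisfies $e_T(h,L)\le\epsilon$ if the step size $h$ and the number of trajectories $L$ are set to $$h=T\,\delta_{g,T,\beta}\,D_{g,T,\beta}^{-1/\beta}\,\epsilon^{1/\beta}\quad\text{and}\quad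 L=\delta_{g,T,\beta}\,D_{g,T,\beta}^2\,\epsilon^{-2},$$ where the constants $\delta_{g,T,\beta}$ and $D_{g,T,\beta}$ depend only on $g,T,\beta$ as follows: $$\delta_{g,T,\beta}=\Big(\frac{\sigma_{g,T}^2}{2\beta\, C_{g,T}\,T^{2\beta}}\Big)^{1/(2\beta)}\quad\text{and}\quad D_{g,T,\beta}=\Big(\frac{\sigma_{g,T}^2}{\delta_{g,T,\beta}}+C_{g,T}\,T^{2\beta}\,\delta_{g,T,\beta}^{2\beta}\Big)^{1/2}.$$ In particular, $e_T(h,L)\le\epsilon$ if the total sampling complexity (total number of sampled Poisson points over all $L$ trajectories) is $$\Big(\sum_{i,j}\alpha_{ij}+\sum_{i}\gamma_i\Big)T\,\delta_{g,T,\beta}\,D_{g,T,\beta}^2\,\epsilon^{-2}=O(\epsilon^{-2})$$ in expectation (the sums being over edges $(i,j)\in\mathcal{E}$ and nodes $i\in\mathcal{V}$), and the computation complexity (total cost of all scheme steps over the $L$ trajectories, each step costing $O(m+n)$) is $$O\big((m+n)(\epsilon/D_{g,T,\beta})^{-(2\beta+1)/\beta}\big)=O(\epsilon^{-(2\beta+1)/\beta}).$$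
   Context: **Network.** $\mathcal{G}=(\mathcal{V},\mathcal{E})$ is a given directed graph with $\mathcal{V}=\{1,\dots,n\}$, $\mathcal{E}\subset\mathcal{V}\times\mathcal{V}$, $m=|\mathcal{E}|$. Each edge $(i,j)\in\mathcal{E}$ carries an activation rate $\alpha_{ij}>0$ and each node $i$ a recovery rate $\gamma_i>0$ (in the model without recovery, the recovery terms are absent). Let $\mathcal{V}_j^+=\{i:(i,j)\in\mathcal{E}\}$, with elements listed as $k_1<k_2<\dots$. **Jump SDE.** $N_{ij}(t)$, $(i,j)\in\mathcal{E}$, and $R_i(t)$, $i\in\mathcal{V}$, are independent homogeneous Poisson processes with intensities $\alpha_{ij}$ and $\gamma_i$, respectively, starting at $0$. Put $\bm{R}(t)=(R_1(t),\dots,R_n(t))^\top$, $\bm{N}_{\cdot j}(t)=(N_{k_1j}(t),N_{k_2j}(t),\dots)^\top\in\mathbb{R}^{|\mathcal{V}_j^+|}$, $\bm{N}(t)=(\bm{N}_{\cdot1}(t)^\top,\dots,\bm{N}_{\cdot n}(t)^\top)^\top\in\mathbb{R}^m$, $\bm{J}(t)=(\bm{R}(t)^\top,\bm{N}(t)^\top)^\top\in\mathbb{R}^{n+m}$. For $\bm{X}=(X_1,\dots,X_n)^\top\in\mathbb{R}^n$ let $\bm{c}_0(\bm{X})=\mathrm{diag}(X_1,\dots,X_n)$, $\bm{b}_j(\bm{X})=((1-X_j)X_{k_1},(1-X_j)X_{k_2},\dots)^\top\in\mathbb{R}^{|\mathcal{V}_j^+|}$, let $\bm{c}_1(\bm{X})\in\mathbb{R}^{n\times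 m}$ be the block-diagonal matrix with $(j,j)$-block the row vector $\bm{b}_j(\bm{X})^\top$, and $\bm{c}(\bm{X})=[-\bm{c}_0(\bm{X}),\bm{c}_1(\bm{X})]\in\mathbb{R}^{n\times(n+m)}$. The process $\bm{X}(t)$ is the right-continuous solution with left limits of $d\bm{X}(t)=\bm{c}(\bm{X}(t^-))\,d\bm{J}(t)$, i.e. $dX_j(t)=(1-X_j(t^-))\sum_{i\in\mathcal{V}_j^+}X_i(t^-)\,dN_{ij}(t)-X_j(t^-)\,dR_j(t)$, with initial value $X_i(0)=1$ if $i$ is a source node (in a known source set) and $X_i(0)=0$ otherwise. **Schemes.** For a step size $h$, let $t_k=kh$ for $k=0,1,\dots,T/h$, $\bm{X}^h_0=\bm{X}(0)$, $\bm{X}^h_k=\bm{X}^h(t_k)$ and $\Delta\bm{J}_k=\bm{J}(t_{k+1})-\bm{J}(t_k)$ (independent Poisson entries with means $\gamma_ih$ and $\alpha_{ij}h$). The Euler scheme (weak order $\beta=1$) is $\bm{X}^h_{k+1}=\bm{X}^h_k+\bm{c}(\bm{X}^h_k)\Delta\bm{J}_k$. The Taylor scheme (weak order $\beta=2$) is $\bm{X}^h_{k+.5}=\bm{X}^h_k+\bm{c}_k\Delta\bm{J}_k$, $\bm{X}^h_{k+1}=\bm{X}^h_k+\bm{c}_k\Delta\bm{J}_k+\tfrac12(\bm{c}_{k+.5}-\bm{c}_k)\,\Delta\bm{J}_k(\Delta\bm{J}_k-1)$, where $\bm{c}_k=\bm{c}(\bm{X}^h_k)$, $\bm{c}_{k+.5}=\bm{c}(\bm{X}^h_{k+.5})$,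 and the subtraction and product in $\Delta\bm{J}_k(\Delta\bm{J}_k-1)$ are componentwise. **Weak order.** $C_P^{r}(\mathbb{R}^n;\mathbb{R})$ is the space of $r$ times continuously differentiable functions with partial derivatives of polynomial growth. An approximation $\bm{X}^h$ converges to $\bm{X}$ at weak order $\beta>0$ if for any $g\in C_P^{2\beta+2}(\mathbb{R}^n;\mathbb{R})$ there is a constant $C_{g,T}>0$ independent of $h$ such that $|\mathbb{E}[g(\bm{X}^h(T))]-\mathbb{E}[g(\bm{X}(T))]|\le C_{g,T}h^\beta$ for all sufficiently small $h>0$. **Algorithm.** Let $K=T/h$ and $\bm{t}_k=[kh,(k+1)h)$ for $k=0,\dots,K-1$. For each $l=1,\dots,L/2$: for each node $i$ (resp. each edge $(i,j)$), let $F$ be the cumulative distribution function of the Poisson distribution with mean $\gamma_iT$ (resp. $\alpha_{ij}T$), draw $U\sim\mathrm{Uniform}(0,1)$, set $Z^+=F^{-1}(1-U)$ and $Z^-=F^{-1}(U)$, and sample $Z^+$ points and $Z^-$ points independently and uniformly on $[0,T]$; the $Z^+$ points are used for trajectory $\ell=l$ and the $Z^-$ points for trajectory $\ell=L/2+l$. The increments $(\Delta\bm{R}_k^\ell)_i$ (resp. $(\Delta\bm{N}_k^\ell)_{ij}$) are the numbers of the corresponding points lying in $\bm{t}_k$. Running the chosen scheme with these increments as $\Delta\bm{J}_k$ yields $\bm{X}^{h,\ell}(T)$ for $\ell=l$ and $\ell=L/2+l$. The output is $u_T(h,L)=\frac1L\sum_{\ell=1}^{L}g(\bm{X}^{h,\ell}(T))$.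 Each trajectory takes $T/h$ scheme steps. **Standing assumptions.** Without loss of generality $h\in(0,1)$ and $T/h$ is an integer; for ease of presentation $L$ is even.
   Formalization: As displayed, δ and D fail for some C>1; proved with C² in place of C in δ and D, and as displayed for any enlarged constant at least max(C, C²). Also assumes σ>0, and treats h, L either as exactly admissible or rounded to T/h integer and L even. *)

(* Defs.v *)
From HB Require Import structures.
From mathcomp Require Import all_boot all_order all_algebra.
From mathcomp Require Import all_classical all_reals all_analysis.

Set Implicit Arguments.
Unset Strict Implicit.
Unset Printing Implicit Defensive.

Import Order.TTheory GRing.Theory Num.Theory.
Import numFieldNormedType.Exports.

Local Open Scope classical_set_scope.
Local Open Scope ring_scope.

(** ** Network and coefficient of the jump SDE *)

(* Index set of the n + m components of J: [inl i] is the recovery of node i,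
   [inr e] the activation along the edge e.  Self-loops are allowed. *)
Definition channel (n : nat) (E : {set 'I_n * 'I_n}) : finType :=
  ('I_n + {e : 'I_n * 'I_n | e \in E})%type.

Definition rate (R : realType) (n : nat) (E : {set 'I_n * 'I_n})
    (alpha : 'I_n * 'I_n -> R) (gamma : 'I_n -> R) (c : channel E) : R :=
  match c with inl i => gamma i | inr e => alpha (val e) end.

(* The n x (n+m) matrix c(x) = [-c_0(x), c_1(x)], with columns indexed by
   channels: column i of -c_0 is -x_i e_i, and the column of c_1 belonging to
   the edge (i, j) is (1 - x_j) x_i e_j. *)
Definition coef (R : realType) (n : nat) (E : {set 'I_n * 'I_n})
    (x : 'cV[R]_n) (j : 'I_n) (c : channel E) : R :=
  match c with
  | inl i => if j == i then - x i 0 else 0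
  | inr e => if j == (val e).2 then (1 - x j 0) * x (val e).1 0 else 0
  end.

Definition initial_state (R : realType) (n : nat) (src : {set 'I_n}) : 'cV[R]_n :=
  \col_i (i \in src)%:R.

(** ** Independence *)

Definition mutually_independent (R : realType) (d : measure_display)
    (T : measurableType d) (P : probability T R) (I : eqType)
    (X : I -> T -> R) : Prop :=
  forall (s : seq I) (B : I -> set R), uniq s ->
    (forall i, measurable (B i)) ->
    P (\bigcap_(i in [set` s]) (X i @^-1` B i)) =
      (\prod_(i <- s) P (X i @^-1` B i))%E.

(* Independence of finitely many nat-valued processes, through their
   finite-dimensional marginals (point events suffice: the values are discrete). *)
Definition independent_processes (R : realType) (d : measure_display)
    (T : measurableType d) (P : probability T R) (I : finType)
    (N : I -> R -> {RV P >-> nat}) : Prop :=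
  forall (r : nat) (t : 'I_r -> R) (v : I -> 'I_r -> nat),
    (forall k, 0 <= t k) ->
    P [set w | forall i k, N i (t k) w = v i k] =
      (\prod_(i : I) P [set w | forall k, N i (t k) w = v i k])%E.

(** ** Jump SDE driven by Poisson processes *)

Definition left_lim (R : realType) (f : R -> R) (t : R) : R :=
  lim (f s @[s --> t^'-]).

Definition cadlag (R : realType) (f : R -> R) : Prop :=
  (forall t : R, 0 <= t -> f s @[s --> t^'+] --> f t) /\
  (forall t : R, 0 < t -> cvg (f s @[s --> t^'-])).

(* Only times t >= 0 are meaningful.  For lam = 0, [poisson_prob] is the Dirac
   mass at 0, so the process is identically zero. *)
Definition poisson_process (R : realType) (d : measure_display)
    (T : measurableType d) (P : probability T R) (lam : R)
    (N : R -> {RV P >-> nat}) : Prop :=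
  [/\ forall (s t : R) (A : set nat), 0 <= s -> s <= t ->
        P [set w | A (N t w - N s w)%N] = poisson_prob (lam * (t - s)) 0 A,
      forall (r : nat) (t : nat -> R) (v : nat -> nat),
        0 <= t 0%N -> {homo t : k l / (k <= l)%N >-> k <= l} ->
        P [set w | forall k, (k < r)%N -> (N (t k.+1) w - N (t k) w)%N = v k] =
          (\prod_(k < r) P [set w | (N (t k.+1) w - N (t k) w)%N = v k])%E
    & {ae P, forall w, [/\ N 0 w = 0%N,
        forall s t : R, 0 <= s -> s <= t -> (N s w <= N t w)%N
      & cadlag (fun t => (N t w)%:R : R)]} ].

(* X solves dX(t) = c(X(t-)) dJ(t), X(0) = x0.  The paths of J are step functions
   with finitely many jumps on bounded intervals, so the pathwise
   Lebesgue-Stieltjes integral over ]0, t] is the finite-support sum over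
   the jump times s of c(X(s-)) (J(s) - J(s-)). *)
Definition jump_sde_solution (R : realType) (d : measure_display)
    (T : measurableType d) (P : probability T R) (n : nat)
    (E : {set 'I_n * 'I_n}) (J : channel E -> R -> {RV P >-> nat})
    (x0 : 'cV[R]_n) (X : R -> T -> 'cV[R]_n) : Prop :=
  (forall (t : R) (j : 'I_n), 0 <= t -> measurable_fun setT (fun w => X t w j 0)) /\
  {ae P, forall w,
    (forall j, cadlag (fun t => X t w j 0)) /\
    (forall (t : R) (j : 'I_n), 0 <= t ->
       X t w j 0 = x0 j 0 +
         \sum_(c : channel E) \sum_(s \in `]0, t]%classic)
           coef (\col_i left_lim (fun r => X r w i 0) s) j c *
           ((J c s w)%:R - left_lim (fun r => (J c r w)%:R) s))}.

(** ** Numerical schemes *)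

Inductive scheme := Euler | Taylor.

Definition scheme_step (R : realType) (n : nat) (E : {set 'I_n * 'I_n})
    (sch : scheme) (x : 'cV[R]_n) (dJ : channel E -> R) : 'cV[R]_n :=
  let y := x + \col_j \sum_(c : channel E) coef x j c * dJ c in
  match sch with
  | Euler => y
  | Taylor => y + 2^-1 *: \col_j \sum_(c : channel E)
                 (coef y j c - coef x j c) * (dJ c * (dJ c - 1))
  end.

Fixpoint scheme_run (R : realType) (n : nat) (E : {set 'I_n * 'I_n})
    (sch : scheme) (x0 : 'cV[R]_n) (dJ : nat -> channel E -> R) (k : nat) :
    'cV[R]_n :=
  match k with
  | 0%N => x0
  | k'.+1 => scheme_step sch (scheme_run sch x0 dJ k') (dJ k')
  end.

(* X^h(T) for h = Tend / K, driven by the increments of the Poisson processes. *)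
Definition scheme_value (R : realType) (d : measure_display)
    (T : measurableType d) (P : probability T R) (n : nat)
    (E : {set 'I_n * 'I_n}) (J : channel E -> R -> {RV P >-> nat})
    (sch : scheme) (x0 : 'cV[R]_n) (Tend : R) (K : nat) (w : T) : 'cV[R]_n :=
  let h := Tend / K%:R in
  scheme_run sch x0
    (fun k c => (J c (k.+1%:R * h) w)%:R - (J c (k%:R * h) w)%:R) K.

(** ** Antithetic sampling *)

(* F^{-1}(p), the least k with p <= F(k), F being the Poisson cdf; the default
   value 0 is only reached when no such k exists (p >= 1). *)
Definition poisson_quantile (R : realType) (lam p : R) : nat :=
  let above := [set k | (p%:E <= poisson_prob lam 0 [set j | (j <= k)%N])%E] in
  xget 0%N [set k | above k /\ forall j, above j -> (k <= j)%N].

(* Random inputs: [inl (l, c)] is the U of pair l and channel c;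
   [inr (l, b, c, r)] is the r-th uniform point on [0, Tend] available to the
   trajectory b (true: Z^+, false: Z^-) of pair l for channel c. *)
Definition draw (n : nat) (E : {set 'I_n * 'I_n}) : eqType :=
  (nat * channel E + nat * bool * channel E * nat)%type.

Definition sampling_inputs (R : realType) (d : measure_display)
    (S : measurableType d) (Q : probability S R) (n : nat)
    (E : {set 'I_n * 'I_n}) (Tend : R) (T0 : 0 < Tend)
    (V : draw E -> {RV Q >-> R}) : Prop :=
  [/\ mutually_independent Q (fun i => V i : S -> R),
      forall lc (A : set R), measurable A ->
        distribution Q (V (inl lc)) A = uniform_prob (@ltr01 R) A
    & forall lbcr (A : set R), measurable A ->
        distribution Q (V (inr lbcr)) A = uniform_prob T0 A].

Definition num_points (R : realType) (d : measure_display)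
    (S : measurableType d) (Q : probability S R) (n : nat)
    (E : {set 'I_n * 'I_n}) (alpha : 'I_n * 'I_n -> R) (gamma : 'I_n -> R)
    (Tend : R) (V : draw E -> {RV Q >-> R})
    (l : nat) (b : bool) (c : channel E) (w : S) : nat :=
  let u := V (inl (l, c)) w in
  poisson_quantile (rate alpha gamma c * Tend) (if b then 1 - u else u).

(* Trajectory numbers 0 <= l < L: the first half are the Z^+ trajectories of the
   pairs 0, ..., L/2 - 1, the second half the Z^- trajectories. *)
Definition traj_pair (L l : nat) : nat * bool :=
  if (l < L./2)%N then (l, true) else ((l - L./2)%N, false).

Definition sampled_increment (R : realType) (d : measure_display)
    (S : measurableType d) (Q : probability S R) (n : nat)
    (E : {set 'I_n * 'I_n}) (alpha : 'I_n * 'I_n -> R) (gamma : 'I_n -> R)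
    (Tend : R) (V : draw E -> {RV Q >-> R}) (K : nat)
    (p : nat * bool) (w : S) (k : nat) (c : channel E) : nat :=
  let h := Tend / K%:R in
  (\sum_(r < num_points alpha gamma Tend V p.1 p.2 c w)
     (k%:R * h <= V (inr (p.1, p.2, c, r : nat)) w < k.+1%:R * h)%R)%N.

(* u_T(h, L) with h = Tend / K. *)
Definition antithetic_estimator (R : realType) (d : measure_display)
    (S : measurableType d) (Q : probability S R) (n : nat)
    (E : {set 'I_n * 'I_n}) (alpha : 'I_n * 'I_n -> R) (gamma : 'I_n -> R)
    (Tend : R) (V : draw E -> {RV Q >-> R}) (sch : scheme) (x0 : 'cV[R]_n)
    (g : 'cV[R]_n -> R) (K L : nat) (w : S) : R :=
  L%:R^-1 * \sum_(l < L)
    g (scheme_run sch x0 (fun k c =>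
         (sampled_increment alpha gamma Tend V K (traj_pair L l) w k c)%:R) K).

Definition total_points (R : realType) (d : measure_display)
    (S : measurableType d) (Q : probability S R) (n : nat)
    (E : {set 'I_n * 'I_n}) (alpha : 'I_n * 'I_n -> R) (gamma : 'I_n -> R)
    (Tend : R) (V : draw E -> {RV Q >-> R}) (L : nat) (w : S) : nat :=
  (\sum_(l < L) \sum_(c : channel E)
     num_points alpha gamma Tend V (traj_pair L l).1 (traj_pair L l).2 c w)%N.

Definition rmse (R : realType) (d : measure_display) (S : measurableType d)
    (Q : probability S R) (u : S -> R) (mu : R) : \bar R :=
  ('E_Q[(fun w => `|u w - mu| ^+ 2)%R] `^ (2^-1))%E.

(** ** Growth, error bounds and parameter choice *)

Definition euclidean_norm (R : realType) (n : nat) (x : 'cV[R]_n) : R :=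
  Num.sqrt (\sum_i x i 0 ^+ 2).

Definition polynomial_growth (R : realType) (n : nat) (g : 'cV[R]_n -> R) : Prop :=
  exists (C : R) (s : nat), [/\ 0 < C, (0 < s)%N &
    forall x, g x <= C * (1 + euclidean_norm x ^+ s)].

(* Step sizes are h = Tend / K, below a threshold h0 <= 1. *)
Definition admissible_step (R : realType) (Tend h0 : R) (K : nat) : Prop :=
  (0 < K)%N /\ Tend / K%:R < h0.

Definition admissible_size (L : nat) : Prop := (0 < L)%N /\ ~~ odd L.

(* [Xh K] is X^h(T) for h = Tend / K. *)
Definition weak_error_bound (R : realType) (d : measure_display)
    (T : measurableType d) (P : probability T R) (n : nat)
    (g : 'cV[R]_n -> R) (XT : T -> 'cV[R]_n) (Xh : nat -> T -> 'cV[R]_n)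
    (Tend h0 beta C : R) : Prop :=
  forall K, admissible_step Tend h0 K ->
    (`| 'E_P[(fun w => g (Xh K w))] - 'E_P[(fun w => g (XT w))] | <=
      (C * (Tend / K%:R) `^ beta)%:E)%E.

(* [e K L] is e_T(h, L) for h = Tend / K. *)
Definition rmse_bound (R : realType) (e : nat -> nat -> \bar R)
    (Tend h0 beta sigma C : R) : Prop :=
  forall K L, admissible_step Tend h0 K -> admissible_size L ->
    (e K L <= ((sigma ^+ 2 / L%:R + C ^+ 2 * (Tend / K%:R) `^ (2 * beta))
                 `^ (2^-1))%:E)%E.

(* A is the coefficient of (Tend * delta)^(2 beta) in the formulas below.  The
   squared error bound sigma^2 / L + C^2 h^(2 beta) gives RMSE at most eps as
   soon as C^2 <= A: the values of interest are A = C^2, and A = C for an error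
   constant C that can be so chosen. *)
Definition delta_cst (R : realType) (Tend beta sigma A : R) : R :=
  (sigma ^+ 2 / (2 * beta * A * Tend `^ (2 * beta))) `^ (1 / (2 * beta)).

Definition D_cst (R : realType) (Tend beta sigma A : R) : R :=
  let delta := delta_cst Tend beta sigma A in
  (sigma ^+ 2 / delta + A * Tend `^ (2 * beta) * delta `^ (2 * beta)) `^ (1 / 2).

Definition step_choice (R : realType) (Tend beta sigma A eps : R) : R :=
  Tend * delta_cst Tend beta sigma A *
    D_cst Tend beta sigma A `^ (- (1 / beta)) * eps `^ (1 / beta).

Definition size_choice (R : realType) (Tend beta sigma A eps : R) : R :=
  delta_cst Tend beta sigma A * D_cst Tend beta sigma A ^+ 2 * eps ^- 2.

(* Smallest K with Tend / K <= h, and smallest even L at least the prescribed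
   one; both are exact when Tend / h is an integer, resp. the size is even. *)
Definition rounded_steps (R : realType) (Tend beta sigma A eps : R) : nat :=
  `|Num.ceil (Tend / step_choice Tend beta sigma A eps)|%N.

Definition rounded_size (R : realType) (Tend beta sigma A eps : R) : nat :=
  (`|Num.ceil (size_choice Tend beta sigma A eps / 2)|%N).*2.

Definition total_cost (R : realType) (cost : nat -> nat -> nat -> nat -> R)
    (K L : nat) : R :=
  \sum_(l < L) \sum_(k < K) cost K L l k.

(* [e K L], [pts L]: RMSE and expected number of sampled points with K steps and L
   trajectories; [Lam]: total intensity; [size]: m + n; [cost K L l k]: cost of
   step k of trajectory l, at most kappa * size.  First part: the
   prescribed h and L are themselves admissible.  Second part: any eps, with the
   prescribed values rounded to admissible ones. *)
Definition complexity_guarantee (R : realType) (e : nat -> nat -> \bar R)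
    (pts : nat -> \bar R) (cost : nat -> nat -> nat -> nat -> R)
    (Tend h0 beta sigma A Lam kappa : R) (size : nat) : Prop :=
  let delta := delta_cst Tend beta sigma A in
  let D := D_cst Tend beta sigma A in
  let Kr := rounded_steps Tend beta sigma A in
  let Lr := rounded_size Tend beta sigma A in
  (forall (eps : R) (K L : nat), 0 < eps ->
     admissible_step Tend h0 K -> admissible_size L ->
     Tend / K%:R = step_choice Tend beta sigma A eps ->
     L%:R = size_choice Tend beta sigma A eps ->
     [/\ (e K L <= eps%:E)%E,
         pts L = (Lam * Tend * delta * D ^+ 2 * eps ^- 2)%:E
       & total_cost cost K L <=
           kappa * (size%:R * (eps / D) `^ (- ((2 * beta + 1) / beta)))]) /\
  [/\ forall eps : R, 0 < eps -> admissible_step Tend h0 (Kr eps) ->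
        (e (Kr eps) (Lr eps) <= eps%:E)%E,
      forall eps : R, 0 < eps ->
        pts (Lr eps) = (Lam * Tend * (Lr eps)%:R)%:E,
      (fun eps : R => fine (pts (Lr eps)) : R^o)
        =O_ (0^'+) (fun eps : R => eps ^- 2 : R^o),
      (fun eps : R => total_cost cost (Kr eps) (Lr eps) : R^o)
        =O_ (0^'+) (fun eps : R =>
          size%:R * (eps / D) `^ (- ((2 * beta + 1) / beta)) : R^o)
    & (fun eps : R => total_cost cost (Kr eps) (Lr eps) : R^o)
        =O_ (0^'+) (fun eps : R => eps `^ (- ((2 * beta + 1) / beta)) : R^o)].

(* Main.v *)
Require Import Defs.
From HB Require Import structures.
From mathcomp Require Import all_boot all_order all_algebra.
From mathcomp Require Import all_classical all_reals all_analysis.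
From mathcomp Require Import measurable_realfun ring lra.

Set Implicit Arguments.
Unset Strict Implicit.
Unset Printing Implicit Defensive.

Import Order.TTheory GRing.Theory Num.Theory.
Import numFieldNormedType.Exports.

Local Open Scope classical_set_scope.
Local Open Scope ring_scope.

(** Write h and L for the prescribed step size and number of trajectories.  Since
    h^(2 beta) = (T delta)^(2 beta) eps^2 / D^2 and L = delta D^2 / eps^2, the
    two terms of the squared error bound are both multiples of eps^2 / D^2:
    sigma^2 / L + A h^(2 beta) =
      (sigma^2 / delta + A (T delta)^(2 beta)) eps^2 / D^2 = eps^2,
    because D^2 is by definition the bracket; for C^2 <= A the left-hand side
    bounds the squared error.
    The powers of delta cancel in the number of scheme steps,
    (T / h) L = (eps / D)^(-(2 beta + 1) / beta).  Rounding to integers only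
    improves the error, and for eps <= 1 it multiplies the two counts by bounded
    factors, since T / h and L are at least their values at eps = 1.

    The expected number of sampled points is exact for every L.  By inverse
    transform sampling, F^{-1}(U) equals k exactly when U lies between two
    consecutive values of the Poisson distribution function F, and these
    intervals have the Poisson probabilities as lengths; the same holds for 1 - U.
    Hence both members of an antithetic pair have Poisson marginals, of mean
    rate * T, and linearity of the expectation, indifferent to the dependence
    within a pair, does the rest.

    [choice_sqr_error], [choice_complexity] and [expected_total_points] carry
    these facts, and [complexity_guarantee_of_rmse_bound] combines them. *)

(** * The prescribed step size and number of trajectories *)

Section ParameterChoice.
Variables (R : realType) (Tend beta sigma A : R).
Hypotheses (T0 : 0 < Tend) (beta_gt0 : 0 < beta) (sigma_gt0 : 0 < sigma)
  (A_gt0 : 0 < A).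

Let delta := delta_cst Tend beta sigma A.
Let D := D_cst Tend beta sigma A.

Lemma delta_cst_gt0 : 0 < delta.
Proof.
by rewrite powR_gt0// divr_gt0 ?exprn_gt0// !mulr_gt0// powR_gt0.
Qed.

Lemma D_cst_sqr :
  D ^+ 2 = sigma ^+ 2 / delta + A * Tend `^ (2 * beta) * delta `^ (2 * beta).
Proof.
have X0 : 0 <= sigma ^+ 2 / delta + A * Tend `^ (2 * beta) * delta `^ (2 * beta).
  apply: addr_ge0; last by rewrite !mulr_ge0 ?powR_ge0// ltW.
  by apply: divr_ge0; [exact: exprn_ge0 (ltW _)|exact: ltW delta_cst_gt0].
by rewrite /D /D_cst div1r powR12_sqrt// sqr_sqrtr.
Qed.

Lemma D_cst_gt0 : 0 < D.
Proof.
apply: powR_gt0; apply: addr_gt0.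
  by rewrite divr_gt0 ?exprn_gt0 ?delta_cst_gt0.
by rewrite !mulr_gt0// powR_gt0// delta_cst_gt0.
Qed.

Lemma step_choice_gt0 (eps : R) : 0 < eps -> 0 < step_choice Tend beta sigma A eps.
Proof.
move=> e0; have dlt := delta_cst_gt0; have D0 := D_cst_gt0.
by rewrite /step_choice !mulr_gt0// powR_gt0.
Qed.

Lemma size_choice_gt0 (eps : R) : 0 < eps -> 0 < size_choice Tend beta sigma A eps.
Proof.
move=> e0; have dlt := delta_cst_gt0; have D0 := D_cst_gt0.
by rewrite /size_choice !mulr_gt0// ?invr_gt0 exprn_gt0.
Qed.

Lemma step_choice_powR (eps : R) : 0 < eps ->
  step_choice Tend beta sigma A eps `^ (2 * beta) =
  Tend `^ (2 * beta) * delta `^ (2 * beta) * (D ^+ 2)^-1 * eps ^+ 2.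
Proof.
move=> e0; have b0 : beta != 0 by rewrite gt_eqF.
have dlt := delta_cst_gt0; have D0 := D_cst_gt0.
rewrite /step_choice -/delta -/D; move: (delta) (D) dlt D0 => dl D' dlt D0.
rewrite !powRM ?mulr_ge0 ?powR_ge0 1?ltW//.
rewrite -!powRrM (_ : - (1 / beta) * _ = - 2%:R); last by field.
rewrite (_ : 1 / beta * _ = 2%:R); last by field.
by rewrite powRN !powR_mulrn// ltW.
Qed.

(** The factor D^2 that both terms share is, by [D_cst_sqr], exactly what their
    sum needs in order to collapse to eps^2. *)
Lemma choice_sqr_error (eps C : R) : 0 < eps -> C ^+ 2 <= A ->
  sigma ^+ 2 / size_choice Tend beta sigma A eps +
    C ^+ 2 * step_choice Tend beta sigma A eps `^ (2 * beta) <= eps ^+ 2.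
Proof.
move=> e0 CA; have dlt := delta_cst_gt0; have D0 := D_cst_gt0.
apply: (@le_trans _ _ (sigma ^+ 2 / size_choice Tend beta sigma A eps +
    A * step_choice Tend beta sigma A eps `^ (2 * beta))).
  by rewrite lerD2l ler_wpM2r// powR_ge0.
rewrite step_choice_powR// /size_choice -/delta -/D.
rewrite [leLHS](_ : _ = (sigma ^+ 2 / delta +
  A * Tend `^ (2 * beta) * delta `^ (2 * beta)) / D ^+ 2 * eps ^+ 2).
  by rewrite -D_cst_sqr divff ?mul1r// gt_eqF ?exprn_gt0.
field; rewrite !gt_eqF//.
Qed.

(** The number of steps times the number of trajectories: delta cancels between
    the two, leaving D^(2 + 1 / beta) eps^(-(2 + 1 / beta)). *)
Lemma choice_complexity (eps : R) : 0 < eps ->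
  Tend / step_choice Tend beta sigma A eps * size_choice Tend beta sigma A eps =
  (eps / D) `^ (- ((2 * beta + 1) / beta)).
Proof.
move=> e0; have dlt := delta_cst_gt0; have D0 := D_cst_gt0.
rewrite /step_choice /size_choice -/delta -/D.
move: (delta) (D) dlt D0 => dl D' dlt D0.
rewrite (_ : (2 * beta + 1) / beta = 2%:R + 1 / beta); last first.
  by field; rewrite gt_eqF.
rewrite powRN powRD; last by rewrite (gt_eqF (divr_gt0 e0 D0)) implybT.
rewrite powR_mulrn ?divr_ge0 1?ltW//.
have DV : D'^-1 `^ (1 / beta) = (D' `^ (1 / beta))^-1.
  by rewrite -(powR_inv1 (ltW D0)) -powRrM mulrC powRrM powR_inv1 ?powR_ge0.
rewrite powRM ?invr_ge0 1?ltW// DV.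
have := powR_gt0 (1 / beta) e0; have := powR_gt0 (1 / beta) D0.
rewrite powRN; move: (eps `^ _) (D' `^ _) => u v v0 u0.
field.
by rewrite !gt_eqF.
Qed.

End ParameterChoice.

(** * Rounding to integers *)

Section Rounding.
Variables (R : realType) (Tend beta sigma A : R).
Hypotheses (T0 : 0 < Tend) (beta_gt0 : 0 < beta) (sigma_gt0 : 0 < sigma)
  (A_gt0 : 0 < A).

Let h := step_choice Tend beta sigma A.
Let L := size_choice Tend beta sigma A.
Let Kr := rounded_steps Tend beta sigma A.
Let Lr := rounded_size Tend beta sigma A.

Lemma natr_ceil (x : R) : 0 < x ->
  x <= `|Num.ceil x|%N%:R /\ `|Num.ceil x|%N%:R <= x + 1.
Proof.
move=> x0; have c0 : 0 <= Num.ceil x by rewrite ltW// ceil_gt0.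
rewrite natr_absz ger0_norm//; split; first exact: ceil_ge.
by have := ceilB1_lt x; rewrite intrD mulrN1z ltrBlDr => /ltW.
Qed.

Lemma rounded_size_ge (eps : R) : 0 < eps -> L eps <= (Lr eps)%:R.
Proof.
move=> e0; have L0 : 0 < L eps by exact: size_choice_gt0.
have [+ _] := natr_ceil (divr_gt0 L0 (@ltr0Sn R 1)).
by rewrite ler_pdivrMr// -natrM muln2.
Qed.

Lemma admissible_rounded_size (eps : R) : 0 < eps -> admissible_size (Lr eps).
Proof.
move=> e0; split; last by rewrite odd_double.
by rewrite -(ltr_nat R) (lt_le_trans _ (rounded_size_ge e0))// size_choice_gt0.
Qed.

Lemma rounded_steps_ge (eps : R) : 0 < eps -> Tend / (Kr eps)%:R <= h eps.
Proof.
move=> e0; have h_gt0 : 0 < h eps by exact: step_choice_gt0.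
have Th0 : 0 < Tend / h eps by rewrite divr_gt0.
have [+ _] := natr_ceil Th0; rewrite -/(Kr eps) => le_K.
rewrite ler_pdivrMr; last exact: lt_le_trans le_K.
by rewrite mulrC -ler_pdivrMr.
Qed.

(** Rounding up to an even number adds at most 2, and L eps >= L 1 turns this
    additive loss into a factor. *)
Lemma rounded_size_le (eps : R) : 0 < eps -> eps <= 1 ->
  (Lr eps)%:R <= (1 + 2 / L 1) * L eps.
Proof.
move=> e0 e1; have L1 : 0 < L 1 by exact: size_choice_gt0.
have L0 : 0 < L eps by exact: size_choice_gt0.
have [_] := natr_ceil (divr_gt0 L0 (@ltr0Sn R 1)); rewrite -(ler_pM2r (@ltr0Sn R 1)).
rewrite -natrM muln2 mulrDl mul1r divfK// => /le_trans; apply.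
rewrite mulrDl mul1r lerD2l mulrAC ler_pdivlMr// ler_pM2l//.
rewrite /L /size_choice ler_pM2l; last first.
  by rewrite mulr_gt0 ?exprn_gt0 ?D_cst_gt0// delta_cst_gt0.
by rewrite expr1n invr1 invf_ge1 ?exprn_gt0// exprn_ile1// ltW.
Qed.

(** Rounding adds at most 1, and T / h eps >= T / h 1 turns this additive loss
    into a factor. *)
Lemma rounded_steps_le (eps : R) : 0 < eps -> eps <= 1 ->
  (Kr eps)%:R <= (1 + h 1 / Tend) * (Tend / h eps).
Proof.
move=> e0 e1; have h1 : 0 < h 1 by exact: step_choice_gt0.
have h_gt0 : 0 < h eps by exact: step_choice_gt0.
have [_] := natr_ceil (divr_gt0 T0 h_gt0) => /le_trans; apply.
rewrite mulrDl mul1r lerD2l mulrA divfK ?gt_eqF// ler_pdivlMr// mul1r.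
rewrite /h /step_choice ler_pM2l; last first.
  apply: mulr_gt0; last exact/powR_gt0/D_cst_gt0.
  by apply: mulr_gt0 => //; exact: delta_cst_gt0.
by apply: ge0_ler_powR => //; rewrite ?nnegrE ?divr_ge0// ltW.
Qed.

End Rounding.

(** * Asymptotic complexity *)

Lemma bigO_at_right0 (R : realType) (f g : R -> R) (k : R) :
    (forall eps, 0 < eps -> eps <= 1 -> `|f eps| <= k * `|g eps|) ->
  (f : R -> R^o) =O_ (0^'+) (g : R -> R^o).
Proof.
move=> fg; apply/eqO_exP; exists (`|k| + 1); first by rewrite ltr_wpDl.
have e0 : \forall e \near (0:R)^'+, 0 < e by exact: nbhs_right_gt.
have e1 : \forall e \near (0:R)^'+, e < 1 by exact: nbhs_right_lt.
near=> e; have ep : 0 < e by near: e.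
have el : e < 1 by near: e.
apply: le_trans (fg e ep (ltW el)) _.
by rewrite ler_wpM2r// ler_wpDr// ler_norm.
Unshelve. all: by end_near. Qed.

Section TotalCost.
Variables (R : realType) (cost : nat -> nat -> nat -> nat -> R) (c : R).
Hypothesis cost_bound : forall K L l k, 0 <= cost K L l k <= c.

Lemma total_cost_ge0 K L : 0 <= total_cost cost K L.
Proof.
by apply: sumr_ge0 => l _; apply: sumr_ge0 => k _; case/andP: (cost_bound K L l k).
Qed.

Lemma total_cost_le K L : total_cost cost K L <= c * (K%:R * L%:R).
Proof.
apply: (@le_trans _ _ (\sum_(l < L) \sum_(k < K) c)).
  by apply: ler_sum => l _; apply: ler_sum => k _; case/andP: (cost_bound K L l k).
by rewrite !sumr_const !card_ord -mulrnA -[leLHS]mulr_natr natrM.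
Qed.

End TotalCost.

(** The trade-off between h and L is pure arithmetic, so the error, the
    sampling cost and the step cost enter only through the three bounds that
    this arithmetic uses.  [choice_sqr_error] bounds the error, and each
    complexity is the number of trajectories or of steps, estimated by
    [choice_complexity] and the rounding lemmas. *)
Lemma complexity_guarantee_of_rmse_bound (R : realType)
    (e : nat -> nat -> \bar R) (pts : nat -> \bar R)
    (cost : nat -> nat -> nat -> nat -> R)
    (Tend h0 beta sigma C A Lam kappa : R) (size : nat) :
    0 < Tend -> 0 < beta -> 0 < sigma -> 0 < A -> C ^+ 2 <= A ->
    rmse_bound e Tend h0 beta sigma C ->
    (forall L, pts L = (Lam * Tend * L%:R)%:E) ->
    (forall K L l k, 0 <= cost K L l k <= kappa * size%:R) ->
  complexity_guarantee e pts cost Tend h0 beta sigma A Lam kappa size.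
Proof.
move=> T0 beta_gt0 sigma_gt0 A_gt0 CA eB ptsE cost_bound.
have dlt : 0 < delta_cst Tend beta sigma A by exact: delta_cst_gt0.
have D0 : 0 < D_cst Tend beta sigma A by exact: D_cst_gt0.
(* Stated with inequalities, so that it covers the prescribed values as well as
   their roundings. *)
have rmse_le eps K L : 0 < eps -> admissible_step Tend h0 K -> admissible_size L ->
    Tend / K%:R <= step_choice Tend beta sigma A eps ->
    size_choice Tend beta sigma A eps <= L%:R -> (e K L <= eps%:E)%E.
  move=> e0 hK hL Kh Ls; apply: (le_trans (eB K L hK hL)); rewrite lee_fin.
  have sL : 0 < size_choice Tend beta sigma A eps by exact: size_choice_gt0.
  rewrite powR12_sqrt; last first.
    apply: addr_ge0; first by rewrite divr_ge0// sqr_ge0.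
    by rewrite mulr_ge0 ?powR_ge0// sqr_ge0.
  rewrite -[leRHS](ger0_norm (ltW e0)) -sqrtr_sqr ler_wsqrtr//.
  apply: le_trans (choice_sqr_error T0 beta_gt0 sigma_gt0 A_gt0 e0 CA).
  apply: lerD.
    by rewrite ler_wpM2l ?sqr_ge0// lef_pV2// posrE// (lt_le_trans sL).
  rewrite ler_wpM2l ?sqr_ge0// ge0_ler_powR ?nnegrE//.
  - by rewrite mulr_ge0// ltW.
  - by rewrite divr_ge0// ltW.
  - exact: ltW (step_choice_gt0 _ _ _ _ _).
have kS : 0 <= kappa * size%:R.
  by have /andP[+ /(le_trans _)] := cost_bound 0%N 0%N 0%N 0%N => c0; apply.
have costO (eps : R) : 0 < eps -> eps <= 1 ->
    `|total_cost cost (rounded_steps Tend beta sigma A eps)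
       (rounded_size Tend beta sigma A eps)| <=
    kappa * size%:R *
      ((1 + step_choice Tend beta sigma A 1 / Tend) *
       (1 + 2 / size_choice Tend beta sigma A 1)) *
    (eps / D_cst Tend beta sigma A) `^ (- ((2 * beta + 1) / beta)).
  move=> e0 e1; rewrite ger0_norm ?(total_cost_ge0 cost_bound)//.
  apply: le_trans (total_cost_le cost_bound _ _) _.
  rewrite -[leRHS]mulrA ler_wpM2l// -choice_complexity// mulrACA.
  by rewrite ler_pM ?ler0n ?rounded_size_le ?rounded_steps_le.
split=> [eps K L e0 hK hL KE LE|].
  split; first by apply: (rmse_le eps); rewrite ?KE ?LE.
    by rewrite ptsE LE /size_choice; congr EFin; ring.
  apply: le_trans (total_cost_le cost_bound _ _) _.
  rewrite -choice_complexity// -LE -KE [leRHS]mulrA ler_wpM2l//.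
  by rewrite invf_div mulrCA divff ?mulr1// gt_eqF.
split.
- move=> eps e0 hK; apply: rmse_le => //; first exact: admissible_rounded_size.
    exact: rounded_steps_ge.
  exact: rounded_size_ge.
- by move=> eps _; exact: ptsE.
- apply: (bigO_at_right0 (k := `|Lam * Tend| *
     ((1 + 2 / size_choice Tend beta sigma A 1) *
      (delta_cst Tend beta sigma A * D_cst Tend beta sigma A ^+ 2)))).
  move=> eps e0 e1; rewrite ptsE /= normrM -mulrA ler_wpM2l//.
  rewrite ger0_norm// (ger0_norm (x := eps ^- 2)) ?invr_ge0 ?sqr_ge0//.
  by rewrite -mulrA; exact: rounded_size_le.
- apply: (bigO_at_right0 (k := kappa *
      ((1 + step_choice Tend beta sigma A 1 / Tend) *
       (1 + 2 / size_choice Tend beta sigma A 1)))) => eps e0 e1.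
  apply: (le_trans (costO eps e0 e1)); rewrite ger0_norm ?mulr_ge0 ?powR_ge0//.
  by lra.
- apply: (bigO_at_right0 (k := kappa * size%:R *
      ((1 + step_choice Tend beta sigma A 1 / Tend) *
       (1 + 2 / size_choice Tend beta sigma A 1)) *
      (D_cst Tend beta sigma A)^-1 `^ (- ((2 * beta + 1) / beta)))) => eps e0 e1.
  apply: (le_trans (costO eps e0 e1)); rewrite ger0_norm ?powR_ge0//.
  by rewrite (powRM _ (ltW e0)) ?invr_ge0 ?(ltW D0)//; lra.
Qed.

(** * Quantiles of the Poisson distribution *)

Section PoissonQuantile.
Variables (R : realType) (lam : R).

Let mu : probability nat R := poisson_prob lam 0.

(** The distribution function with its index shifted by one: it starts from 0, so
    that the intervals from one value to the next tile the unit interval. *)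
Definition poisson_below (k : nat) : R := fine (mu [set j | (j < k)%N]).

Let belowE k : (poisson_below k)%:E = mu [set j | (j < k)%N].
Proof. by rewrite fineK// fin_num_measure. Qed.

Lemma poisson_below0 : poisson_below 0 = 0.
Proof.
by apply: EFin_inj; rewrite belowE (_ : [set _ | _] = set0) ?measure0// -subset0.
Qed.

Lemma poisson_below_ge0 k : 0 <= poisson_below k.
Proof. by rewrite -lee_fin belowE. Qed.

Lemma poisson_below_le1 k : poisson_below k <= 1.
Proof. by rewrite -lee_fin belowE probability_le1. Qed.

Lemma le_poisson_below : {homo poisson_below : j k / (j <= k)%N >-> j <= k}.
Proof.
move=> j k jk; rewrite -lee_fin !belowE le_measure ?inE// => i /= ij.
exact: leq_trans ij jk.
Qed.

Lemma poisson_belowS k :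
  (poisson_below k.+1 - poisson_below k)%:E = mu [set k].
Proof.
rewrite EFinB !belowE (_ : [set j | (j < k.+1)%N] =
    [set j | (j < k)%N] `|` [set k]); last first.
  apply/seteqP; split=> j /=; last by case=> [/ltnW|->].
  by rewrite ltnS leq_eqVlt => /orP[/eqP|]; [right|left].
rewrite measureU//; last by apply/seteqP; split=> j // -[/= jk jE]; rewrite jE ltnn in jk.
by rewrite addeAC subee ?add0e// fin_num_measure.
Qed.

Let above p : set nat := [set k | p <= poisson_below k.+1].

Lemma poisson_quantileE p : poisson_quantile lam p =
  xget 0%N [set k | above p k /\ forall j, above p j -> (k <= j)%N].
Proof.
rewrite /poisson_quantile (_ : [set k | (_ <= _)%E] = above p)//.
by apply/seteqP; split=> k /=; rewrite /above/= -lee_fin belowE.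
Qed.

Lemma poisson_quantile_itv p j :
  poisson_below j < p <= poisson_below j.+1 -> poisson_quantile lam p = j.
Proof.
move=> /andP[jp pj]; rewrite poisson_quantileE; apply: xget_subset1 => /=.
  split=> // i pi; rewrite leqNgt; apply/negP => ij.
  by have := lt_le_trans jp (le_trans pi (le_poisson_below ij)); rewrite ltxx.
by move=> i k [pi imin] [pk kmin]; apply/eqP; rewrite eqn_leq imin// kmin.
Qed.

(** The second alternative is the default value of the quantile, taken at the
    levels that the distribution function never reaches.  It keeps the
    sublevel sets explicit on the whole line, as measurability requires. *)
Lemma poisson_quantile_le p k : (poisson_quantile lam p <= k)%N <->
  p <= poisson_below k.+1 \/ forall i, poisson_below i.+1 < p.
Proof.
rewrite poisson_quantileE; case: (pselect (exists i, above p i)) => [ex|nex].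
  have [m pm mmin] := ex_minnP (P := fun i => p <= poisson_below i.+1) ex.
  rewrite (@xget_subset1 _ 0%N _ m)//=; last first.
    by move=> i j [pi imin] [pj jmin]; apply/eqP; rewrite eqn_leq imin// jmin.
  split=> [mk|[/mmin//|/(_ m)]]; last by rewrite ltNge pm.
  by left; rewrite (le_trans pm)// le_poisson_below.
rewrite xgetPN; last by move=> i [pi _]; apply: nex; exists i.
split=> // _; right => i; rewrite ltNge; apply/negP => pi.
by apply: nex; exists i.
Qed.

Lemma measurable_poisson_quantile :
  measurable_fun setT (poisson_quantile lam : R -> nat).
Proof.
have mle k : measurable [set p | (poisson_quantile lam p <= k)%N].
  rewrite (_ : [set _ | _] = `]-oo, poisson_below k.+1]%classic `|`
      \bigcap_i `]poisson_below i.+1, +oo[%classic).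
    by apply: measurableU => //; exact: bigcapT_measurable.
  apply/seteqP; split=> p /=; rewrite poisson_quantile_le in_itv/=.
    by case=> [|pN]; [left|right => i _ /=; rewrite in_itv/= andbT].
  by case=> [|pN]; [left|right => i; have /= := pN i I; rewrite in_itv/= andbT].
move=> _ Y _; rewrite setTI.
rewrite (_ : _ @^-1` Y = \bigcup_(k in Y)
    ([set p | (poisson_quantile lam p <= k)%N] `\`
     [set p | (poisson_quantile lam p < k)%N])).
  apply: bigcup_measurable => k _; apply: measurableD => //.
  case: k => [|k]; last exact: mle.
  by rewrite (_ : [set _ | _] = set0)// -subset0.
apply/seteqP; split=> [p Yp|p [k Yk [/= pk /negP]]].
  by exists (poisson_quantile lam p) => //=; split=> //=; rewrite ltnn.
by rewrite -leqNgt => kp; rewrite (_ : poisson_quantile lam p = k)//; apply/eqP;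
  rewrite eqn_leq pk.
Qed.

End PoissonQuantile.

(** * Inverse transform sampling *)

Section PoissonMean.
Variables (R : realType) (lam : R).
Local Open Scope ereal_scope.

Lemma nneseries_poisson : \sum_(0 <= k <oo) poisson_prob lam 0 [set k] = 1.
Proof.
rewrite -(@probability_setT _ _ _ (poisson_prob lam 0)).
rewrite (_ : [set: nat] = \bigcup_(k in setT) [set k]); last first.
  by apply/seteqP; split=> k // _; exists k.
rewrite measure_bigcup//; last by move=> i j _ _ [k [/= -> ->]].
apply: eq_eseriesl => i. by rewrite mem_set.
Qed.

(** By the identity (k + 1) pmf (k + 1) = lam pmf k, the series of the mean is
    lam times the series of the probabilities. *)
Lemma poisson_mean : (0 <= lam)%R ->
  \sum_(0 <= k <oo) (k%:R%:E * poisson_prob lam 0 [set k]) = lam%:E.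
Proof.
rewrite le_eqVlt => /predU1P[<-|lam0].
  apply: eseries0 => -[|k] _ _; first by rewrite mul0e.
  by rewrite /poisson_prob ltxx diracE memNset ?mule0.
rewrite nneseries_recl//; last by move=> k _; rewrite mule_ge0// lee_fin.
rewrite mul0e add0e -[X in X = _](@nneseries_addn _ _ 1); last first.
  by move=> k; rewrite mule_ge0// lee_fin.
under eq_eseriesr => k _.
  rewrite addn1 (_ : _ * _ = lam%:E * poisson_prob lam 0 [set k]); last first.
    rewrite /poisson_prob lam0 !esum_set1 ?lee_fin ?poisson_pmf_ge0//.
    rewrite /poisson_pmf lam0 -!EFinM; congr EFin.
    rewrite factS exprS natrM; field.
    by rewrite pnatr_eq0 -lt0n fact_gt0 nat1r pnatr_eq0.
  over.
by rewrite nneseriesZl// nneseries_poisson mule1.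
Qed.

End PoissonMean.

Section InverseTransform.
Variables (R : realType) (d : measure_display) (S : measurableType d)
  (Q : probability S R) (W : S -> R) (lam : R).
Hypotheses (mW : measurable_fun setT W)
  (W_unif : forall a b, 0 <= a -> a <= b -> b <= 1 ->
    Q [set w | a < W w <= b] = (b - a)%:E).
Local Open Scope ereal_scope.

(** The events that W falls between consecutive values of the distribution
    function are disjoint and of total mass 1, so the integral is the sum of
    its parts over them; on each, the quantile is constant.  That only
    intervals enter the hypothesis on W lets it serve for U and for 1 - U alike. *)
Lemma integral_poisson_quantile : (0 <= lam)%R ->
  \int[Q]_w (poisson_quantile lam (W w))%:R%:E = lam%:E.
Proof.
move=> lam_ge0.
(* A k is the event that the quantile of W is k, up to a null event. *)
pose A k := [set w | (poisson_below lam k < W w <= poisson_below lam k.+1)%R].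
have QA k : Q (A k) = poisson_prob lam 0 [set k].
  rewrite W_unif ?poisson_belowS ?poisson_below_ge0 ?poisson_below_le1//.
  exact: le_poisson_below.
have mA k : measurable (A k).
  rewrite -[A k]setTI (_ : A k = W @^-1`
      `]poisson_below lam k, poisson_below lam k.+1]%classic).
    exact: mW.
  by apply/seteqP; split=> w /=; rewrite in_itv.
have qA k w : A k w -> poisson_quantile lam (W w) = k by exact: poisson_quantile_itv.
have tA : trivIset setT A by move=> i j _ _ [w [/qA <- /qA <-]].
have mU : measurable (\bigcup_k A k) by exact: bigcupT_measurable.
have N0 : Q (~` \bigcup_k A k) = 0.
  rewrite probability_setC// measure_semi_bigcup//.
  by rewrite (eq_eseriesr (fun k _ => QA k)) nneseries_poisson subee.
have mq : measurable_fun setT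
    (EFin \o (fun w => (poisson_quantile lam (W w))%:R : R)).
  apply/measurable_EFinP; apply: (measurableT_comp (f := fun k : nat => k%:R : R)) => //.
  exact: measurableT_comp (measurable_poisson_quantile lam) mW.
have q0 w : 0 <= (poisson_quantile lam (W w))%:R%:E :> \bar R by rewrite lee_fin.
rewrite (ge0_negligible_integral _ _ _ _ N0)//; last exact: measurableC.
rewrite setTD setCK ge0_integral_bigcup//; last exact: measurable_funTS.
rewrite -[RHS]poisson_mean//; apply: eq_eseriesr => k _; rewrite -QA -integral_cst//.
by apply: eq_integral => w; rewrite inE => /qA ->.
Qed.

End InverseTransform.

Section UniformLaw.
Variables (R : realType).

Lemma uniform_prob01 (i : interval R) : [set` i] `<=` `[0, 1] ->
  uniform_prob (@ltr01 R) [set` i] = lebesgue_measure [set` i].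
Proof.
move=> i01; rewrite -[RHS]mul1e -integral_cst//.
apply: eq_integral => x; rewrite inE => /i01/=; rewrite in_itv/= => x01.
by rewrite /uniform_pdf x01 subr0 invr1.
Qed.

Variables (d : measure_display) (S : measurableType d) (Q : probability S R)
  (U : {RV Q >-> R}).
Hypothesis U_unif : forall A, measurable A ->
  distribution Q U A = uniform_prob (@ltr01 R) A.

Lemma uniform_itv_oc (a b : R) : 0 <= a -> a <= b -> b <= 1 ->
  Q [set w | a < U w <= b] = (b - a)%:E.
Proof.
move=> a0 ab b1; transitivity (distribution Q U `]a, b]%classic).
  by congr (Q _); apply/seteqP; split=> w /=; rewrite in_itv.
rewrite U_unif// uniform_prob01.
  rewrite lebesgue_measure_itv/= lte_fin; case: ltgtP ab => // -> _.
  by rewrite subrr.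
move=> x /=; rewrite !in_itv/= => /andP[ax xb].
by rewrite (le_trans a0 (ltW ax)) (le_trans xb).
Qed.

(** Reflection swaps the ends of the interval that are open and closed, which
    leaves its length unchanged. *)
Lemma uniform_itv_oc_antithetic (a b : R) : 0 <= a -> a <= b -> b <= 1 ->
  Q [set w | a < 1 - U w <= b] = (b - a)%:E.
Proof.
move=> a0 ab b1; transitivity (distribution Q U `[1 - b, 1 - a[%classic).
  congr (Q _); apply/seteqP; split=> w /=; rewrite in_itv/= => /andP[? ?];
    by apply/andP; split; lra.
rewrite U_unif// uniform_prob01.
  rewrite lebesgue_measure_itv/= lte_fin ltrD2l ltrN2.
  case: ltgtP ab => // [ab|->] _; last by rewrite subrr.
  by rewrite -EFinB; congr EFin; lra.
move=> x /=; rewrite !in_itv/= => /andP[? ?].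
by apply/andP; split; lra.
Qed.

End UniformLaw.

(** * Expected number of sampled points *)

Section ExpectedPoints.
Variables (R : realType) (n : nat) (E : {set 'I_n * 'I_n}).
Variables (alpha : 'I_n * 'I_n -> R) (gamma : 'I_n -> R).

Lemma sum_rate : \sum_(c : channel E) rate alpha gamma c =
  \sum_(ij in E) alpha ij + \sum_i gamma i.
Proof.
rewrite big_sumType/= addrC; congr (_ + _).
by rewrite [RHS]big_sub.
Qed.

Variables (d : measure_display) (S : measurableType d) (Q : probability S R)
  (Tend : R) (T0 : 0 < Tend) (V : draw E -> {RV Q >-> R}).
Hypotheses (rate_ge0 : forall c : channel E, 0 <= rate alpha gamma c)
  (V_unif : forall lc (A : set R), measurable A ->
     distribution Q (V (inl lc)) A = uniform_prob (@ltr01 R) A).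

Let W l b c w : R := if b then 1 - V (inl (l, c)) w else V (inl (l, c)) w.

Let mW l b c : measurable_fun setT (W l b c).
Proof.
by case: b; rewrite /W//; apply: measurable_funB.
Qed.

Lemma measurable_num_points l b c :
  measurable_fun setT
    (EFin \o (fun w => (num_points alpha gamma Tend V l b c w)%:R : R)).
Proof.
apply/measurable_EFinP; apply: (measurableT_comp (f := fun k : nat => k%:R : R)) => //.
exact: measurableT_comp (measurable_poisson_quantile _) (mW l b c).
Qed.

Lemma expected_num_points l b c :
  (\int[Q]_w (num_points alpha gamma Tend V l b c w)%:R%:E =
   (rate alpha gamma c * Tend)%:E)%E.
Proof.
apply: (integral_poisson_quantile (mW l b c)); last by rewrite mulr_ge0// ltW.
move=> a a' a0 aa' a1; case: b; rewrite /W.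
  exact: uniform_itv_oc_antithetic (V_unif _) _ _ _ _ _.
exact: uniform_itv_oc (V_unif _) _ _ _ _ _.
Qed.

Lemma expected_total_points L :
  ('E_Q[(fun w => (total_points alpha gamma Tend V L w)%:R)%R] =
   ((\sum_(ij in E) alpha ij + \sum_i gamma i) * Tend * L%:R)%:E)%E.
Proof.
rewrite unlock /total_points.
under eq_integral do rewrite natr_sum -sumEFin.
rewrite ge0_integral_sum//=; last first.
  move=> l; under eq_fun do rewrite natr_sum -sumEFin.
  by apply: emeasurable_sum => c; exact: measurable_num_points.
rewrite (eq_bigr (fun=> ((\sum_(ij in E) alpha ij + \sum_i gamma i) * Tend)%:E)).
  by rewrite sumEFin sumr_const card_ord mulr_natr.
move=> l _; under eq_integral do rewrite natr_sum -sumEFin.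
rewrite ge0_integral_sum//=.
- by rewrite -sum_rate mulr_suml -sumEFin; apply: eq_bigr => c _;
    rewrite expected_num_points.
- by move=> c; exact: measurable_num_points.
Qed.

End ExpectedPoints.

(** * The complexity of antithetic sampling *)

Theorem corollary2 (R : realType)
  (n : nat) (E : {set 'I_n * 'I_n}) (src : {set 'I_n})
  (alpha : 'I_n * 'I_n -> R) (gamma : 'I_n -> R)
  (alpha_gt0 : forall e, e \in E -> 0 < alpha e)
  (gamma_gt0 : (forall i, 0 < gamma i) \/ (forall i, gamma i = 0))
  (dP : measure_display) (Omega : measurableType dP) (P : probability Omega R)
  (J : channel E -> R -> {RV P >-> nat})
  (J_poisson : forall c, poisson_process (rate alpha gamma c) (J c))
  (J_indep : independent_processes J)
  (X : R -> Omega -> 'cV[R]_n)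
  (X_sol : jump_sde_solution J (initial_state R src) X)
  (Tend : R) (T0 : 0 < Tend)
  (dQ : measure_display) (S : measurableType dQ) (Q : probability S R)
  (V : draw E -> {RV Q >-> R}) (V_inputs : sampling_inputs T0 V)
  (sch : scheme) (beta : R) (beta_gt0 : 0 < beta)
  (g : 'cV[R]_n -> R)
  (g_growth : polynomial_growth g)
  (g_sq : ('E_P[(fun w => g (X Tend w) ^+ 2)%R] < +oo)%E)
  (cost : nat -> nat -> nat -> nat -> R) (kappa : R)
  (cost_bound : forall K L l k, 0 <= cost K L l k <= kappa * (#|E| + n)%:R)
  (h0 : R) (h0_gt0 : 0 < h0) (h0_le1 : h0 <= 1)
  (C sigma : R) (C_gt0 : 0 < C) (sigma_gt0 : 0 < sigma) :
  let x0 := initial_state R src in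
  let mu := fine ('E_P[(fun w => g (X Tend w))%R])%E in
  let u := antithetic_estimator alpha gamma Tend V sch x0 g in
  let e K L := rmse Q (u K L) mu in
  let pts L := ('E_Q[(fun w => (total_points alpha gamma Tend V L w)%:R)%R])%E in
  let Lam := \sum_(ij in E) alpha ij + \sum_i gamma i in
  let weak_bound :=
    weak_error_bound P g (X Tend) (scheme_value J sch x0 Tend) Tend h0 beta in
  let guarantee A :=
    complexity_guarantee e pts cost Tend h0 beta sigma A Lam kappa (#|E| + n) in
  weak_bound C -> rmse_bound e Tend h0 beta sigma C ->
  guarantee (C ^+ 2) /\
  (forall C1 : R, C <= C1 -> C ^+ 2 <= C1 ->
     [/\ weak_bound C1, rmse_bound e Tend h0 beta sigma C1 & guarantee C1]).
Proof.
move=> x0 mu u e pts Lam weak_bound guarantee weakC rmseC.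
have rate_ge0 (c : channel E) : 0 <= rate alpha gamma c.
  case: c => [i|[ij ijE]] /=; last exact: ltW (alpha_gt0 _ ijE).
  by case: gamma_gt0 => [/(_ i)/ltW|->].
have ptsE L : pts L = (Lam * Tend * L%:R)%:E.
  by case: V_inputs => _ V_unif _; exact: expected_total_points.
have main A : 0 < A -> C ^+ 2 <= A -> guarantee A.
  by move=> A0 CA; exact: (complexity_guarantee_of_rmse_bound (C := C)).
split; first by apply: main => //; rewrite exprn_gt0.
move=> C1 CC1 C2C1; have C1_gt0 : 0 < C1 by exact: lt_le_trans CC1.
split; last exact: main.
- move=> K hK; apply: (le_trans (weakC K hK)).
  by rewrite lee_fin ler_wpM2r// powR_ge0.
- move=> K L hK hL; apply: (le_trans (rmseC K L hK hL)).
  have sq0 (c : R) : 0 <= sigma ^+ 2 / L%:R + c ^+ 2 * (Tend / K%:R) `^ (2 * beta).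
    apply: addr_ge0; first by rewrite divr_ge0// sqr_ge0.
    by rewrite mulr_ge0 ?powR_ge0// sqr_ge0.
  rewrite lee_fin ge0_ler_powR ?nnegrE//.
  by rewrite lerD2l ler_wpM2r ?powR_ge0// ler_sqr ?nnegrE// ltW.
Qed.
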